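(* Let $(\Omega, \mathcal{F}, \mathbb{F}, \mathbf{P})$ be a filtered probability space with filtration $\mathbb{F} = (\mathcal{F}_t)_{t \in [0,\infty)}$, and let $X = (X_t)_{t \in [0,\infty)}$ be a real-valued, progressively measurable, almost surely right-continuous process. Assume that: (i) $X_\tau \in L^1$ and $\mathbb{E}[X_\tau] = \mathbb{E}[X_0]$ for all finite stopping times $\tau$; and (ii) there exist a $(0,1)$-uniformly distributed random variable $U$ and a finite stopping time $\eta$ such that $U$ is $\mathcal{F}_\eta$-measurable. Then $X$ is a uniformly integrable martingale.
   Context: The filtration satisfies $\mathcal{F}_\infty = \bigvee_{t \in [0,\infty)} \mathcal{F}_t \subset \mathcal{F}$; it is not assumed to be right-continuous or complete. Martingales, stopping times and progressive measurability are with respect to $\mathbb{F}$; $\mathcal{F}_\eta$ is the usual $\sigma$-algebra of events up to the stopping time $\eta$. $\mathbb{E}$ is expectation under $\mathbf{P}$; $Z \in L^1$ means $\mathbb{E}[|Z|] < \infty$. All identifications and statements are understood in the almost-sure sense; in particular, a finite stopping time is one with $\tau < \infty$ almost surely. *)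

(* Defs.v *)
From HB Require Import structures.
From mathcomp Require Import all_boot all_order all_algebra.
From mathcomp Require Import all_classical all_reals all_analysis.

Set Implicit Arguments.
Unset Strict Implicit.
Unset Printing Implicit Defensive.

Import Order.TTheory GRing.Theory Num.Theory.
Import numFieldNormedType.Exports.

Local Open Scope classical_set_scope.
Local Open Scope ring_scope.
Local Open Scope ereal_scope.

(* Time is [0, +oo[ inside R: filtrations and processes are indexed by R, and
   every definition below only looks at their values at times t >= 0.  A
   sub-sigma-algebra is a set of sets G; measurability with respect to G is
   measurability on the library's g_sigma_algebraType G, whose measurable sets
   are the elements of G when G is a sigma-algebra. *)

(* No right-continuity or completeness is required. *)
Record filtration d (T : measurableType d) (R : realType)
    (F : R -> set (set T)) : Prop := Filtration {
  filtration_sigma_algebra :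
    forall t : R, (0 <= t)%R -> sigma_algebra [set: T] (F t) ;
  filtration_measurable :
    forall t : R, (0 <= t)%R -> F t `<=` d.-measurable ;
  filtration_nondecreasing :
    forall s t : R, (0 <= s <= t)%R -> F s `<=` F t }.

Definition filtration_infty d (T : measurableType d) (R : realType)
    (F : R -> set (set T)) : set (set T) :=
  <<s \bigcup_(t in [set t : R | (0 <= t)%R]) F t >>.

Definition measurable_wrt d (T : measurableType d) (R : realType)
    (G : set (set T)) (Y : T -> R) : Prop :=
  measurable_fun [set: g_sigma_algebraType G] Y.

(* A measurable_fun on the domain [0, t] x T is measurable for the trace of
   B(R) (x) F_t on that domain, which is B([0, t]) (x) F_t. *)
Definition progressively_measurable d (T : measurableType d) (R : realType)
    (F : R -> set (set T)) (X : R -> T -> R) : Prop :=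
  forall t : R, (0 <= t)%R ->
    measurable_fun
      (`[0%R, t] `*` [set: T] : set (R * g_sigma_algebraType (F t)))
      (fun z : R * g_sigma_algebraType (F t) => X z.1 z.2).

Definition as_right_continuous d (T : measurableType d) (R : realType)
    (P : probability T R) (X : R -> T -> R) : Prop :=
  {ae P, forall w, forall t : R, (0 <= t)%R -> X s w @[s --> t^'+] --> X t w}.

Definition stopping_time d (T : measurableType d) (R : realType)
    (F : R -> set (set T)) (tau : T -> \bar R) : Prop :=
  (forall w, 0 <= tau w) /\
  forall t : R, (0 <= t)%R -> F t [set w | tau w <= t%:E].

Definition finite_stopping_time d (T : measurableType d) (R : realType)
    (P : probability T R) (F : R -> set (set T)) (tau : T -> \bar R) : Prop :=
  stopping_time F tau /\ {ae P, forall w, tau w < +oo}.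

Definition stopped_sigma_algebra d (T : measurableType d) (R : realType)
    (F : R -> set (set T)) (tau : T -> \bar R) : set (set T) :=
  [set A | filtration_infty F A /\
     forall t : R, (0 <= t)%R -> F t (A `&` [set w | tau w <= t%:E])].

(* X_tau; the value 0 on {tau = +oo} is a convention without effect, as it is
   only used for tau finite almost surely. *)
Definition stopped_value (T : Type) (R : realType)
    (X : R -> T -> R) (tau : T -> \bar R) (w : T) : R :=
  if tau w is t%:E then X t w else 0%R.

Definition L1 d (T : measurableType d) (R : realType) (P : probability T R)
    (Y : T -> R) : Prop :=
  P.-integrable [set: T] (EFin \o Y).

(* Z is a version of E[Y | G]. *)
Definition is_cond_expectation d (T : measurableType d) (R : realType)
    (P : probability T R) (G : set (set T)) (Y Z : T -> R) : Prop :=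
  [/\ measurable_wrt G Z, L1 P Z &
      forall A, G A -> \int[P]_(w in A) (Z w)%:E = \int[P]_(w in A) (Y w)%:E].

Definition martingale d (T : measurableType d) (R : realType)
    (P : probability T R) (F : R -> set (set T)) (X : R -> T -> R) : Prop :=
  [/\ forall t : R, (0 <= t)%R -> measurable_wrt (F t) (X t),
      forall t : R, (0 <= t)%R -> L1 P (X t) &
      forall s t : R, (0 <= s <= t)%R ->
        is_cond_expectation P (F s) (X t) (X s)].

(* The family (Y_i), i in D. *)
Definition uniformly_integrable d (T : measurableType d) (R : realType)
    (P : probability T R) (I : Type) (D : set I) (Y : I -> T -> R) : Prop :=
  ereal_sup [set \int[P]_(w in [set w | (K < `|Y i w|)%R]) `|Y i w|%:E
            | i in D] @[K --> +oo%R] --> 0.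

(* Main.v *)
Require Import Defs.
From HB Require Import structures.
From mathcomp Require Import all_boot all_order all_algebra.
From mathcomp Require Import all_classical all_reals all_analysis.
From mathcomp Require Import measurable_realfun ring lra.

(** The martingale property is the classical switching argument: if A is an
    event of the common past of two finite stopping times sigma and tau, the
    time equal to tau on A and to sigma off A is again a finite stopping time,
    so that constancy of the mean gives equal integrals of X_sigma and X_tau
    over A ([integral_stopped_eq]).  Constant times give the martingale
    property; general times give conditional Jensen inequalities for the convex
    functions (|x| - K)^+ ([le_integral_excess_stopped]).

    For uniform integrability no martingale convergence theorem is used; all
    the work is done by pasting countably many stopping times together and
    using that the value at the pasted time is integrable.

    - Tails ([exists_small_tail]).  If the events G_n of the past of rho
      decrease to a null set, then sup E[|X_tau|; G_n] over the finite
      tau >= rho tends to 0.  Otherwise, with the supremum always above a > 0,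
      one picks successively disjoint shells G_k \ G_m and times tau_k carrying
      mass at least a on them; the time equal to tau_k on the k-th shell has a
      non-integrable value.

    - L1 bound ([stopped_L1_bounded]).  Call a set J of reals good when
      E[|X_tau|; U in J] is bounded over the finite tau >= eta.  If the whole
      line were not good, let s be the supremum of the x for which ]-oo, x] is
      good.  No neighbourhood of s is good, although the events that U is at
      distance at most 1/n from s decrease to {U = s}, which is null because
      the law of U has no atoms.  This contradicts the tail statement.

    - Uniform integrability ([exists_uniform_excess]).  By the L1 bound, the
      supremum over tau of E[(|X_tau| - j)^+] is finite, hence attained up to
      e/2^(j+2) by some s_j, and the s_j can be taken increasing.  On
      {|X_(s_j)| <= j} the excess of X_(s_j) over j vanishes, and by near
      optimality no later value acquires there an excess of more than
      e/2^(j+2).  Stop at s_j for the first j with |X_(s_j)| <= j: by the L1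
      bound this is a finite time rho.  After rho the excess is controlled on
      every piece {stopped at s_j}, and the tail statement disposes of all but
      finitely many pieces.  So one level K makes E[(|X_tau| - K)^+] small for
      every finite tau, in particular for constant ones, and
      |x| <= 2 (|x| - K)^+ for |x| > 2K. *)

Set Implicit Arguments.
Unset Strict Implicit.
Unset Printing Implicit Defensive.

Import Order.TTheory GRing.Theory Num.Theory.
Import numFieldNormedType.Exports.

Local Open Scope classical_set_scope.
Local Open Scope ring_scope.
Local Open Scope ereal_scope.

(** * Stopping times, their past, and pasting *)

Section stopping_times.
Context d (T : measurableType d) (R : realType) (P : probability T R).
Context (F : R -> set (set T)) (hF : filtration F).
Implicit Types (A : set T) (sigma tau : T -> \bar R).

(** The events decided by the time tau.  Only measurability in the ambient
    sigma-algebra is asked of A, in place of membership in the sigma-algebra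
    generated by the filtration: the part of A in {tau = +oo}, which the second
    condition leaves free, is null for a finite tau. *)
Definition prior tau : set (set T) :=
  [set A | measurable A /\
    forall t : R, (0 <= t)%R -> F t (A `&` [set w | tau w <= t%:E])].

Lemma filtrationE t : (0 <= t)%R ->
  @measurable _ (g_sigma_algebraType (F t)) = F t.
Proof.
move=> t0; exact: sigma_algebra_id (filtration_sigma_algebra hF t0).
Qed.

Lemma sigma_algebra_prior tau : stopping_time F tau ->
  sigma_algebra [set: T] (prior tau).
Proof.
move=> [_ mtau]; split.
- split=> // t t0; rewrite set0I.
  by case: (filtration_sigma_algebra hF t0).
- move=> A [mA FA]; split; first exact: measurableD.
  move=> t t0; rewrite -filtrationE//.
  rewrite (_ : _ `&` _ = [set w | tau w <= t%:E] `\`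
                         (A `&` [set w | tau w <= t%:E])).
    by apply: measurableD; rewrite filtrationE//; [exact: mtau|exact: FA].
  by apply/seteqP; split=> w /=; rewrite ?not_andP; tauto.
- move=> A mA; split; first by apply: bigcupT_measurable => n; case: (mA n).
  move=> t t0; rewrite setI_bigcupl -filtrationE//.
  apply: bigcupT_measurable => n; rewrite filtrationE//.
  by case: (mA n) => _; exact.
Qed.

Lemma priorE tau : stopping_time F tau ->
  @measurable _ (g_sigma_algebraType (prior tau)) = prior tau.
Proof. by move=> stau; exact: sigma_algebra_id (sigma_algebra_prior stau). Qed.

Lemma priorT tau : stopping_time F tau -> prior tau [set: T].
Proof. by move=> stau; rewrite -priorE//; exact: measurableT. Qed.

Lemma priorC tau A : stopping_time F tau -> prior tau A -> prior tau (~` A).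
Proof. by move=> stau; rewrite -priorE//; exact: measurableC. Qed.

Lemma priorI tau A B : stopping_time F tau ->
  prior tau A -> prior tau B -> prior tau (A `&` B).
Proof. by move=> stau; rewrite -priorE//; exact: measurableI. Qed.

(** Events of the sigma-algebra at time eta are prior to eta; as the latter form
    a sigma-algebra, this extends to what the former generate. *)
Lemma prior_of_measurable_wrt (U : T -> R) eta (B : set R) :
  stopping_time F eta -> measurable_wrt (stopped_sigma_algebra F eta) U ->
  measurable B -> prior eta (U @^-1` B).
Proof.
move=> se mU mB; have := mU measurableT B mB; rewrite setTI.
apply: smallest_sub; first exact: sigma_algebra_prior.
move=> A [FooA FA]; split => //; move: FooA.
apply: smallest_sub; first exact: sigma_algebra_measurable.
by move=> C [t t0]; exact: (filtration_measurable hF).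
Qed.

Lemma prior_seqDU tau (A : (set T)^nat) n : stopping_time F tau ->
  (forall i, (i <= n)%N -> prior tau (A i)) -> prior tau (seqDU A n).
Proof.
move=> stau mA; rewrite /seqDU setDE.
apply: priorI => //; first exact: mA.
apply: priorC => //; rewrite -priorE//.
by apply: bigsetU_measurable => i _; rewrite priorE//; apply: mA; apply: ltnW.
Qed.

(** On {tau <= t} both times are at most t, so the event {sigma <= t} may be
    intersected for free. *)
Lemma le_prior sigma tau A : stopping_time F tau ->
  (forall w, A w -> sigma w <= tau w) -> prior sigma A -> prior tau A.
Proof.
move=> [_ mtau] st [mA FA]; split=> // t t0.
rewrite (_ : _ `&` _ = (A `&` [set w | sigma w <= t%:E]) `&`
                       [set w | tau w <= t%:E]); last first.
  apply/seteqP; split=> w /=; last by tauto.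
  by move=> [Aw tt]; split => //; split => //; apply: le_trans tt; exact: st.
rewrite -filtrationE//; apply: measurableI; rewrite filtrationE//.
  exact: FA.
exact: mtau.
Qed.

Lemma stopping_time_cst t : (0 <= t)%R -> stopping_time F (cst t%:E).
Proof.
move=> t0; split=> [w|s s0]; first by rewrite /= lee_fin.
rewrite -filtrationE//.
have [ts|ts] := boolP (t%:E <= s%:E).
  by rewrite (_ : [set _ | _] = setT); [exact: measurableT|apply/seteqP; split].
rewrite (_ : [set _ | _] = set0); [exact: measurable0|].
by apply/seteqP; split => // w /=; rewrite (negbTE ts).
Qed.

Lemma prior_cst s t A : (0 <= s <= t)%R -> F s A -> prior (cst t%:E) A.
Proof.
move=> /andP[s0 st] FA; apply: (le_prior (sigma := cst s%:E)).
- by apply: stopping_time_cst; exact: le_trans st.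
- by move=> w _; rewrite lee_fin.
split; first exact: (filtration_measurable hF s0).
move=> r r0; have [sr|rs] := leP s r.
  rewrite (_ : _ `&` _ = A).
    by apply: (filtration_nondecreasing hF (s := s)) FA; rewrite s0.
  by apply/seteqP; split => [w []|w Aw] //; split => //=; rewrite lee_fin.
rewrite (_ : _ `&` _ = set0); first by case: (filtration_sigma_algebra hF r0).
by apply/seteqP; split => // w [_ /=]; rewrite lee_fin leNgt rs.
Qed.

Lemma finite_stopping_time_cst t : (0 <= t)%R ->
  finite_stopping_time P F (cst t%:E).
Proof.
move=> t0; split; first exact: stopping_time_cst.
by apply: aeW => w; rewrite /= ltry.
Qed.

Lemma stopping_time_max sigma tau : stopping_time F sigma ->
  stopping_time F tau -> stopping_time F (fun w => maxe (sigma w) (tau w)).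
Proof.
move=> [s0 ms] [t0 mt]; split=> [w|t tge0].
  by rewrite le_max s0.
rewrite (_ : [set _ | _] = [set w | sigma w <= t%:E] `&`
                           [set w | tau w <= t%:E]).
  by rewrite -filtrationE//; apply: measurableI; rewrite filtrationE//;
    [exact: ms|exact: mt].
by apply/seteqP; split => w /=; rewrite ge_max => /andP.
Qed.

Lemma finite_stopping_time_max sigma tau : finite_stopping_time P F sigma ->
  finite_stopping_time P F tau ->
  finite_stopping_time P F (fun w => maxe (sigma w) (tau w)).
Proof.
move=> [ss fs] [st ft]; split; first exact: stopping_time_max.
by apply: filterS2 fs ft => w sw tw; rewrite gt_max sw.
Qed.

(** For disjoint A i the infimum is over at most one value, the value of s i on
    A i, and it is +oo outside the union, as befits a time that never comes. *)
Definition paste (A : (set T)^nat) (s : nat -> T -> \bar R) (w : T) : \bar R :=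
  ereal_inf [set s i w | i in [set i | A i w]].

Lemma pasteE (A : (set T)^nat) s i w : trivIset [set: nat] A -> A i w ->
  paste A s w = s i w.
Proof.
move=> tA Aiw; rewrite /paste (_ : [set _ | _ in _] = [set s i w]).
  by rewrite ereal_inf1.
apply/seteqP; split=> [_ [j /= Ajw <-]|_ ->]; last by exists i.
by rewrite (tA j i)//; exists w.
Qed.

Lemma paste_out (A : (set T)^nat) s w : ~ (\bigcup_n A n) w ->
  paste A s w = +oo.
Proof.
move=> nA; rewrite /paste (_ : [set _ | _ in _] = set0) ?ereal_inf0//.
by apply/seteqP; split => // _ [i /= Aiw _]; apply: nA; exists i.
Qed.

(** The event {paste <= t} is the union of the events A i /\ {s i <= t}, each of
    which belongs to F t precisely because A i is prior to s i. *)
Lemma stopping_time_paste (A : (set T)^nat) s : trivIset [set: nat] A ->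
  (forall i, stopping_time F (s i)) -> (forall i, prior (s i) (A i)) ->
  stopping_time F (paste A s).
Proof.
move=> tA ss pA; split=> [w|t t0].
  by apply: le_ereal_inf_tmp => _ [i _ <-]; case: (ss i).
rewrite (_ : [set _ | _] = \bigcup_i (A i `&` [set w | s i w <= t%:E])).
  rewrite -filtrationE//; apply: bigcupT_measurable => i; rewrite filtrationE//.
  by case: (pA i) => _; exact.
apply/seteqP; split=> w /=.
  have [[i _ Aiw]|nA] := pselect ((\bigcup_n A n) w).
    by rewrite (pasteE s tA Aiw) => le_t; exists i.
  by rewrite paste_out// leye_eq.
by move=> [i _ [Aiw le_t]]; rewrite (pasteE s tA Aiw).
Qed.

Lemma prior_paste (A : (set T)^nat) s i : trivIset [set: nat] A ->
  (forall i, stopping_time F (s i)) -> (forall i, prior (s i) (A i)) ->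
  prior (paste A s) (A i).
Proof.
move=> tA ss pA; apply: (le_prior _ _ (pA i)).
  exact: stopping_time_paste.
by move=> w Aiw; rewrite (pasteE s tA Aiw).
Qed.

Lemma finite_stopping_time_paste (A : (set T)^nat) s : trivIset [set: nat] A ->
  {ae P, forall w, (\bigcup_n A n) w} ->
  (forall i, finite_stopping_time P F (s i)) ->
  (forall i, prior (s i) (A i)) ->
  finite_stopping_time P F (paste A s).
Proof.
move=> tA cA ss pA; split.
  by apply: stopping_time_paste => // i; case: (ss i).
have /ae_foralln fs : forall n, \forall w \ae P, s n w < +oo.
  by move=> n; case: (ss n).
by apply: filterS2 fs cA => w sw [i _ Aiw]; rewrite (pasteE s tA Aiw).
Qed.

End stopping_times.

(** * Excesses over a level and uniform integrability *)

Section integration.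
Context d (T : measurableType d) (R : realType) (P : probability T R).
Implicit Types (A : set T) (Y Z : T -> R).

(** A convex function of x at bounded distance from |x|, vanishing for
    |x| <= K: its integral measures the part of the mass of x above K. *)
Definition excess (K x : R) : R := Num.max (`|x| - K)%R 0%R.

Lemma excess_ge0 K x : (0 <= excess K x)%R.
Proof. by rewrite /excess le_max lexx orbT. Qed.

Lemma excess0 x : excess 0 x = `|x|%R.
Proof. by rewrite /excess subr0; apply/max_idPl. Qed.

Lemma excess_eq0 K x : (`|x| <= K)%R -> excess K x = 0%R.
Proof. by move=> xK; apply/max_idPr; rewrite subr_le0. Qed.

Lemma le_excess K L x : (K <= L)%R -> (excess L x <= excess K x)%R.
Proof. by move=> KL; apply: le_max2 => //; rewrite lerB. Qed.

Lemma measurable_excess K A Y : measurable_fun A Y ->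
  measurable_fun A (excess K \o Y).
Proof.
move=> mY; apply: measurable_maxr => //.
apply: measurable_funB => //.
by apply: measurableT_comp mY; exact: normr_measurable.
Qed.

Lemma L1_measurable Y : L1 P Y -> measurable_fun [set: T] Y.
Proof. by move/measurable_int/measurable_EFinP. Qed.

Lemma L1_integrable A Y : measurable A -> L1 P Y ->
  P.-integrable A (EFin \o Y).
Proof. by move=> mA; apply: integrableS. Qed.

Lemma integrable_excess K A Y : (0 <= K)%R -> measurable A -> L1 P Y ->
  P.-integrable A (EFin \o (excess K \o Y)).
Proof.
move=> K0 mA Y1; apply: (le_integrable mA _ _ (L1_integrable mA Y1)) => /=.
  apply/measurable_EFinP; apply: measurable_excess.
  by apply: measurable_funTS; exact: L1_measurable.
move=> w _; rewrite lee_fin ger0_norm ?excess_ge0//.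
by rewrite -[leRHS]excess0; exact: le_excess.
Qed.

Lemma excess_le_integral K A Y : L1 P Y -> (0 <= K)%R -> measurable A ->
  \int[P]_(w in A) (excess K (Y w))%:E <= \int[P]_(w in A) `|Y w|%:E.
Proof.
move=> Y1 K0 mA; have mY := measurable_funTS (L1_measurable Y1).
apply: ge0_le_integral => //.
- by move=> w _; rewrite lee_fin excess_ge0.
- by apply/measurable_EFinP; exact: measurable_excess.
- by apply/measurable_EFinP; exact: measurableT_comp.
- by move=> w _; rewrite lee_fin -[leRHS]excess0 le_excess.
Qed.

(** Jensen's inequality on a set where Y stays on a single affine piece of e:
    the affine function supports e from below, and its values at Y and at Z
    have the same integral. *)
Lemma le_integral_support (e : R -> R) (b c : R) A Y Z : measurable A ->
  P.-integrable A (EFin \o Y) -> P.-integrable A (EFin \o Z) ->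
  P.-integrable A (EFin \o (e \o Z)) ->
  (forall w, A w -> e (Y w) = c * Y w + b)%R ->
  (forall x, c * x + b <= e x)%R ->
  \int[P]_(w in A) (Y w)%:E = \int[P]_(w in A) (Z w)%:E ->
  \int[P]_(w in A) (e (Y w))%:E <= \int[P]_(w in A) (e (Z w))%:E.
Proof.
move=> mA Y1 Z1 eZ1 eY e_ge YZ.
have ib : P.-integrable A (EFin \o cst b).
  by apply: finite_measure_integrable_cst => //; exact: fin_num_fun_lty.
have affine V : P.-integrable A (EFin \o V) ->
    P.-integrable A (EFin \o (fun w => c * V w + b)%R) /\
    \int[P]_(w in A) (c * V w + b)%:E =
    c%:E * \int[P]_(w in A) (V w)%:E + \int[P]_(w in A) b%:E.
  move=> V1; have cV1 := integrableZl mA c V1; split.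
    exact: (integrableD mA cV1 ib).
  by rewrite -integralZl// -(integralD mA cV1 ib).
rewrite (eq_integral (fun w => (c * Y w + b)%:E)); last first.
  by move=> w /[!inE] Aw; rewrite eY.
rewrite (affine Y Y1).2 YZ -(affine Z Z1).2.
apply: le_integral => //; first exact: (affine Z Z1).1.
by move=> w _; rewrite lee_fin.
Qed.

(** Conditional Jensen inequality: the last hypothesis says that on A the
    variable Y is the conditional expectation of Z given Y.  The excess
    has three affine pieces, and A is cut according to the piece in which Y
    lies. *)
Lemma le_integral_excess K A Y Z : (0 <= K)%R -> measurable A ->
  L1 P Y -> L1 P Z ->
  (forall B, measurable B -> \int[P]_(w in A `&` Y @^-1` B) (Y w)%:E =
                             \int[P]_(w in A `&` Y @^-1` B) (Z w)%:E) ->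
  \int[P]_(w in A) (excess K (Y w))%:E <=
  \int[P]_(w in A) (excess K (Z w))%:E.
Proof.
move=> K0 mA Y1 Z1 YZ; have mY := L1_measurable Y1.
have mAY B : measurable B -> measurable (A `&` Y @^-1` B).
  move=> mB; apply: measurableI => //.
  by rewrite -[X in measurable X]setTI; exact: mY.
(* The three affine pieces x - K, - x - K and 0 of the excess. *)
pose A1 := A `&` Y @^-1` [set x | (K < x)%R].
pose A2 := A `&` Y @^-1` [set x | (x < - K)%R].
pose A3 := A `&` Y @^-1` [set x | (- K <= x <= K)%R].
have -> : A = A1 `|` (A2 `|` A3).
  rewrite /A1 /A2 /A3 -!setIUr -!preimage_setU.
  rewrite (_ : _ `|` _ = setT) ?preimage_setT ?setIT//.
  apply/seteqP; split=> //= x _.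
  have [Kx|xK] := ltP K x; first by left.
  by have [xNK|NKx] := ltP x (- K)%R; right; [left|right; rewrite /= NKx].
have mB1 : measurable [set x | (K < x)%R] by rewrite -set_itvoy.
have mB2 : measurable [set x | (x < - K)%R] by rewrite -set_itvNyo.
have mB3 : measurable [set x | (- K <= x <= K)%R] by rewrite -set_itvcc.
have [m1 m2 m3] : [/\ measurable A1, measurable A2 & measurable A3].
  by split; exact: mAY.
have split_int V : measurable_fun setT V ->
    \int[P]_(w in A1 `|` (A2 `|` A3)) (excess K (V w))%:E =
    \int[P]_(w in A1) (excess K (V w))%:E +
    (\int[P]_(w in A2) (excess K (V w))%:E +
     \int[P]_(w in A3) (excess K (V w))%:E).
  move=> mV; have mE B : measurable_fun B (excess K \o V).
    by apply: measurable_excess; exact: measurable_funTS.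
  rewrite !ge0_integral_setU//.
  - by apply/measurable_EFinP.
  - by move=> w _; rewrite lee_fin excess_ge0.
  - by apply/disj_setPS => w [[_ /= wK] [_ /= /andP[]]]; rewrite leNgt wK.
  - exact: measurableU.
  - by apply/measurable_EFinP.
  - by move=> w _; rewrite lee_fin excess_ge0.
  - apply/disj_setPS => w [[_ /= Kw] [[_ /= wK]|[_ /= /andP[_]]]].
      by have : False by lra.
    by rewrite leNgt Kw.
rewrite !split_int//; last exact: L1_measurable.
apply: leeD; last apply: leeD.
- apply: (le_integral_support (c := 1) (b := - K)) => //.
  + exact: L1_integrable.
  + exact: L1_integrable.
  + exact: integrable_excess.
  + move=> w [_ /= Kw].
    rewrite /excess mul1r gtr0_norm ?(le_lt_trans K0)//.
    by apply/max_idPl; rewrite subr_ge0 ltW.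
  + by move=> x; rewrite /excess mul1r le_max lerD2r ler_norm.
  + exact: YZ.
- apply: (le_integral_support (c := -1) (b := - K)) => //.
  + exact: L1_integrable.
  + exact: L1_integrable.
  + exact: integrable_excess.
  + move=> w [_ /= wK].
    rewrite /excess mulN1r ltr0_norm; last first.
      by rewrite (lt_le_trans wK)// oppr_le0.
    by apply/max_idPl; rewrite subr_ge0 lerNr ltW.
  + by move=> x; rewrite /excess mulN1r le_max lerD2r -normrN ler_norm.
  + exact: YZ.
- apply: (le_integral_support (c := 0) (b := 0)) => //.
  + exact: L1_integrable.
  + exact: L1_integrable.
  + exact: integrable_excess.
  + move=> w [_ /= wK].
    by rewrite mul0r addr0 excess_eq0// ler_norml.
  + by move=> x; rewrite mul0r addr0 excess_ge0.
  + exact: YZ.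
Qed.

(** For |y| > 2K one has |y| <= 2 (|y| - K). *)
Lemma integral_tail_le_excess K L Y : L1 P Y -> (0 <= K)%R -> (K *+ 2 <= L)%R ->
  \int[P]_(w in [set w | (L < `|Y w|)%R]) `|Y w|%:E <=
  2%:E * \int[P]_w (excess K (Y w))%:E.
Proof.
move=> Y1 K0 KL; have mY := L1_measurable Y1.
have mE B : measurable_fun B (excess K \o Y).
  by apply: measurable_excess; exact: measurable_funTS.
have m0 : measurable_fun [set: T] (fun w => `|Y w|%R).
  by apply: measurableT_comp mY; exact: normr_measurable.
have mL : measurable [set w | (L < `|Y w|)%R].
  rewrite (_ : [set _ | _] = (fun w => `|Y w|%R) @^-1` `]L, +oo[%classic).
    by rewrite -[X in measurable X]setTI; exact: m0.
  by apply/seteqP; split => w /=; rewrite in_itv/= andbT.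
rewrite -ge0_integralZl//; last 2 first.
- by apply/measurable_EFinP.
- by move=> w _; rewrite lee_fin excess_ge0.
apply: (@le_trans _ _ (\int[P]_(w in [set w | (L < `|Y w|)%R])
    (2%:E * (excess K (Y w))%:E))).
  apply: ge0_le_integral => //.
  - by apply/measurable_EFinP; exact: measurable_funTS.
  - by apply: measurable_funeM; apply/measurable_EFinP.
  - move=> w /= Lw; rewrite -EFinM lee_fin.
    have : (`|Y w| - K <= excess K (Y w))%R by rewrite /excess le_max lexx.
    rewrite mulr2n in KL; lra.
apply: ge0_subset_integral => //.
  by apply: measurable_funeM; apply/measurable_EFinP.
by move=> w _; rewrite -EFinM lee_fin mulr_ge0// excess_ge0.
Qed.

(** The sets G k \ G m increase with m to G k up to a null set, so their
    integrals converge to the integral over G k. *)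
Lemma exists_integral_setD (f : T -> \bar R) (G : (set T)^nat) k (a : \bar R) :
  measurable_fun [set: T] f -> (forall w, 0 <= f w) ->
  (forall n, measurable (G n)) -> nonincreasing_seq G ->
  P (\bigcap_n G n) = 0 ->
  a < \int[P]_(w in G k) f w ->
  exists2 m, (k < m)%N & a < \int[P]_(w in G k `\` G m) f w.
Proof.
move=> mf f0 mG niG G0 a_lt.
have mD n : measurable (G k `\` G n) by exact: measurableD.
have GE : \bigcup_n (G k `\` G n) = G k `\` \bigcap_n G n.
  by rewrite setDE setC_bigcap setI_bigcupr.
have cvg : \int[P]_(w in G k `\` G n) f w @[n --> \oo] -->
    \int[P]_(w in \bigcup_n (G k `\` G n)) f w.
  apply: ge0_nondecreasing_set_cvg_integral => //.
  - by move=> m n mn; apply/subsetPset; apply: setDS; apply/subsetPset/niG.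
  - by move=> n; exact: measurable_funTS.
have mcap : measurable (\bigcap_n G n) by exact: bigcapT_measurable.
rewrite GE -ge0_negligible_integral//= in cvg; last exact: measurable_funTS.
have [n _ n_gt] :=
  cvg _ (open_nbhs_nbhs (conj (@open_ereal_gt_ereal _ a) a_lt)).
exists (maxn k.+1 n); first exact: leq_maxl.
by apply: n_gt => /=; exact: leq_maxr.
Qed.

(** On A the Y n are at least n while their means stay bounded: n P(A) <= c. *)
Lemma null_of_L1_bounded A (Y : nat -> T -> R) (c : R) : measurable A ->
  (forall n, L1 P (Y n)) -> (forall n, \int[P]_w `|Y n w|%:E <= c%:E) ->
  (forall n w, A w -> (n%:R <= `|Y n w|)%R) -> P A = 0.
Proof.
move=> mA Y1 Yc AY.
have mYabs n B : measurable_fun B (fun w => `|Y n w|%:E).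
  apply/measurable_EFinP; apply: measurableT_comp => //.
  by apply: measurable_funTS; exact: L1_measurable.
have le_c n : n%:R%:E * P A <= c%:E.
  apply: le_trans (Yc n); rewrite -integral_cst//.
  apply: (@le_trans _ _ (\int[P]_(w in A) `|Y n w|%:E)).
    apply: ge0_le_integral => //.
    - by move=> w _ /=; rewrite lee_fin.
    - by move=> w Aw; rewrite lee_fin AY.
  by apply: ge0_subset_integral.
apply/eqP; rewrite -measure_le0 leNgt; apply/negP => p0.
have p_fin : P A \is a fin_num by exact: fin_num_measure.
have {}p0 : (0 < fine (P A))%R by rewrite fine_gt0// p0 ltey_eq p_fin.
have := le_c (Num.trunc (c / fine (P A))).+1.
rewrite -[X in _ * X](fineK p_fin) -EFinM lee_fin -ler_pdivlMr//.
by rewrite leNgt truncnS_gt.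
Qed.

Lemma uniformly_integrable_excess (I : Type) (D : set I) (Y : I -> T -> R) :
  (exists i, D i) -> (forall i, D i -> L1 P (Y i)) ->
  (forall e : R, (0 < e)%R -> exists2 K : R, (0 <= K)%R &
     forall i, D i -> \int[P]_w (excess K (Y i w))%:E <= e%:E) ->
  uniformly_integrable P D Y.
Proof.
move=> [i0 Di0] Y1 small; rewrite /uniformly_integrable.
set f := fun K : R => ereal_sup _.
have f0 K : 0 <= f K.
  apply: (@le_trans _ _
    (\int[P]_(w in [set w | (K < `|Y i0 w|)%R]) `|Y i0 w|%:E)).
    by apply: integral_ge0 => w _; rewrite lee_fin.
  by apply: ereal_sup_ubound; exists i0.
have f_le e : (0 < e)%R -> \forall K \near +oo%R, f K <= e%:E.
  move=> e0; have [K K0 KP] := small (e / 2)%R (divr_gt0 e0 (ltr0Sn R 1)).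
  near=> L; apply: ge_ereal_sup => _ [i Di <-].
  have KL : (K *+ 2 <= L)%R by near: L; apply: nbhs_pinfty_ge; rewrite num_real.
  apply: le_trans (integral_tail_le_excess (Y1 i Di) K0 KL) _.
  have -> : e%:E = 2%:E * (e / 2)%:E by rewrite -EFinM; congr EFin; field.
  by apply: lee_wpmul2l => //; exact: KP.
have f_fin : \forall K \near +oo%R, f K \is a fin_num.
  apply: filterS (f_le _ ltr01) => K fK.
  by rewrite ge0_fin_numE//; apply: le_lt_trans fK (ltry _).
apply/fine_cvgP; split => //; apply/cvgr0Pnorm_le => e e0.
apply: filterS2 f_fin (f_le e e0) => K fK fKe.
by rewrite /= ger0_norm ?fine_ge0// -lee_fin fineK.
Unshelve. all: end_near.
Qed.

(** Absolute continuity of the uniform law with respect to Lebesgue measure. *)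
Lemma uniform_atomless (U : {RV P >-> R}) (x : R) :
  (forall B : set R, measurable B ->
    distribution P U B = uniform_prob (@ltr01 R) B) ->
  P (U @^-1` [set x]) = 0.
Proof.
move=> UE; transitivity (distribution P U [set x]) => //.
rewrite UE//.
have /null_content_dominatesP := dominates_uniform_prob (@ltr01 R).
by apply => //; exact: lebesgue_measure_set1.
Qed.

Lemma sum_geometric (e : R) n :
  (\sum_(i < n) e / 2 ^+ i.+1 = e * (1 - (2 ^+ n)^-1))%R.
Proof.
elim: n => [|n IH]; first by rewrite big_ord0 expr0 invr1 subrr mulr0.
rewrite big_ord_recr/= IH exprS.
have : (2 ^+ n != 0 :> R)%R by rewrite expf_neq0.
by move: (2 ^+ n)%R => x x0; field.
Qed.

End integration.

(** * Values of a progressive process at stopping times *)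

Section stopped_values.
Context d (T : measurableType d) (R : realType) (P : probability T R).
Context (F : R -> set (set T)) (hF : filtration F).
Context (X : R -> T -> R) (hX : progressively_measurable F X).

(** The time min(tau, t) is F t-measurable: for 0 <= a < t, the event that it
    exceeds a is the complement of {tau <= a}, which lies in F a. *)
Lemma measurable_stopping_time_min (tau : T -> \bar R) (t : R) :
  stopping_time F tau -> (0 <= t)%R ->
  measurable_fun [set: g_sigma_algebraType (F t)]
    (fun w => fine (mine (tau w) t%:E)).
Proof.
move=> [tau0 mtau] t0 mT.
apply: (measurability _ (RGenOInfty.measurableE R)) => // _ [_ [a ->] <-].
rewrite setTI set_itvoy.
have min_gt w :
    (a < fine (mine (tau w) t%:E))%R = (a < t)%R && ~~ (tau w <= a%:E).
  rewrite -ltNge; have := tau0 w; case: (tau w) => [s||] // _.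
    by rewrite -EFin_min lte_fin/= lt_min andbC.
  by rewrite min_r ?leey//= ltry andbT.
have [ta|a_t] := leP t a.
  rewrite (_ : _ @^-1` _ = set0); first exact: measurable0.
  by apply/seteqP; split => // w /=; rewrite min_gt ltNge ta.
rewrite (_ : _ @^-1` _ = ~` [set w | tau w <= a%:E]); last first.
  by apply/seteqP; split => w /=; rewrite min_gt a_t/= => /negP.
apply: measurableC; have [a0|a0] := ltP a 0%R.
  rewrite (_ : [set _ | _] = set0); first exact: measurable0.
  apply/seteqP; split => // w /= /(le_trans (tau0 w)).
  by rewrite lee_fin leNgt a0.
rewrite filtrationE//; apply: (filtration_nondecreasing hF (s := a)).
  by rewrite a0 ltW.
exact: mtau.
Qed.

Lemma progressive_adapted t : (0 <= t)%R -> measurable_wrt (F t) (X t).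
Proof.
move=> t0.
apply: (measurable_comp (F := `[0%R, t] `*` [set: g_sigma_algebraType (F t)])
  (f := fun z => X z.1 z.2) (g := fun w : g_sigma_algebraType (F t) => (t, w))).
- by apply: measurableX; [exact: measurable_itv|exact: measurableT].
- by move=> _ [w _ <-]; split => //=; rewrite in_itv/= t0 lexx.
- exact: hX.
- apply/measurable_fun_pairP.
  by split; [exact: measurable_cst|exact: measurable_id].
Qed.

(** On {tau <= t} the value at tau is the composition of X with
    w |-> (min (tau w) t, w), which is measurable from F t to the product of
    the Borel sets of [0, t] with F t. *)
Lemma prior_stopped_value (tau : T -> \bar R) (B : set R) :
  stopping_time F tau -> measurable_fun [set: T] (stopped_value X tau) ->
  measurable B -> prior F tau (stopped_value X tau @^-1` B).
Proof.
move=> stau mXtau mB; split.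
  by rewrite -[X in measurable X]setTI; exact: mXtau.
move=> t t0; pose FT := g_sigma_algebraType (F t).
pose phi (w : FT) : R * FT := (fine (mine (tau w) t%:E), w).
have mphi : measurable_fun setT phi.
  apply/measurable_fun_pairP; split; last exact: measurable_id.
  exact: measurable_stopping_time_min.
have mV : measurable_fun [set: FT] ((fun z : R * FT => X z.1 z.2) \o phi).
  apply: (measurable_comp _ _ (hX t0) mphi).
    by apply: measurableX; [exact: measurable_itv|exact: measurableT].
  move=> _ [w _ <-]; split=> //=; rewrite in_itv/=.
  have [tau0 _] := stau.
  have := tau0 w; case: (tau w) => [s||] // s0.
    by rewrite -EFin_min/= ge_min lexx orbT le_min t0 !andbT -lee_fin.
  by rewrite min_r ?leey//= t0 lexx.
have := mV measurableT B mB; rewrite setTI => mVB.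
rewrite (_ : _ `&` _ = ((fun z : R * FT => X z.1 z.2) \o phi) @^-1` B `&`
                       [set w | tau w <= t%:E]); last first.
  apply/seteqP; split=> w /= [XB taut]; split => //; move: XB;
  rewrite /stopped_value (min_idPl taut); move: taut;
  by have [tau0 _] := stau; have := tau0 w; case: (tau w).
rewrite -filtrationE//; apply: measurableI => //.
by rewrite filtrationE//; case: stau => _; exact.
Qed.

End stopped_values.

(** * Processes with constant mean at finite stopping times *)

Section constant_mean.
Context d (T : measurableType d) (R : realType) (P : probability T R).
Context (F : R -> set (set T)) (hF : filtration F).
Context (X : R -> T -> R) (hX : progressively_measurable F X).
Hypothesis hstop : forall tau : T -> \bar R, finite_stopping_time P F tau ->
  L1 P (stopped_value X tau) /\ 'E_P[stopped_value X tau] = 'E_P[X 0%R].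
Implicit Types (A B : set T) (sigma tau rho eta : T -> \bar R).

Lemma stopped_L1 tau : finite_stopping_time P F tau ->
  L1 P (stopped_value X tau).
Proof. by case/hstop. Qed.

Lemma stopped_measurable A tau : finite_stopping_time P F tau ->
  measurable_fun A (stopped_value X tau).
Proof. by move=> /stopped_L1/L1_measurable mX; exact: measurable_funTS. Qed.

Lemma stopped_abs_measurable A tau : finite_stopping_time P F tau ->
  measurable_fun A (fun w => `|stopped_value X tau w|%:E).
Proof.
move=> /(stopped_measurable (A := A)) mX.
by apply/measurable_EFinP; exact: measurableT_comp.
Qed.

Lemma stopped_excess_measurable K A tau : finite_stopping_time P F tau ->
  measurable_fun A (fun w => (excess K (stopped_value X tau w))%:E).
Proof.
move=> /(stopped_measurable (A := A)) mX.
by apply/measurable_EFinP; exact: measurable_excess.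
Qed.

Lemma stopped_value_eq sigma tau w : sigma w = tau w ->
  stopped_value X sigma w = stopped_value X tau w.
Proof. by rewrite /stopped_value => ->. Qed.

Lemma exists_switch sigma tau A : finite_stopping_time P F sigma ->
  finite_stopping_time P F tau -> prior F sigma A -> prior F tau A ->
  exists rho, [/\ finite_stopping_time P F rho,
    forall w, A w -> rho w = tau w & forall w, ~ A w -> rho w = sigma w].
Proof.
move=> fs ft sA tA; pose s i := if i is 0%N then tau else sigma.
have tD : trivIset [set: nat] (bigcup2 A (~` A)).
  by rewrite -trivIset_bigcup2 setICr.
exists (paste (bigcup2 A (~` A)) s); split=> [|w Aw|w nAw].
- apply: finite_stopping_time_paste => //.
  + by rewrite bigcup2E setUv; exact: aeW.
  + by case.
  + move=> [|[|i]] /=; [exact: tA|apply: priorC => //; exact: fs.1|].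
    by rewrite -[set0]setCT; apply: priorC => //; [|apply: priorT => //];
      exact: fs.1.
- by rewrite (@pasteE _ _ _ _ s 0%N).
- by rewrite (@pasteE _ _ _ _ s 1%N).
Qed.

(** The switched time has the same mean as sigma and the same value as sigma off
    A; what remains is the equality of the integrals over A. *)
Lemma integral_stopped_eq sigma tau A : finite_stopping_time P F sigma ->
  finite_stopping_time P F tau -> prior F sigma A -> prior F tau A ->
  \int[P]_(w in A) (stopped_value X sigma w)%:E =
  \int[P]_(w in A) (stopped_value X tau w)%:E.
Proof.
move=> fs ft sA tA; have [rho [fr rA rC]] := exists_switch fs ft sA tA.
have mA : measurable A by case: sA.
have mC : measurable (~` A) by exact: measurableC.
have split_int th : finite_stopping_time P F th ->
    'E_P[stopped_value X th] = \int[P]_(w in A) (stopped_value X th w)%:E +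
                               \int[P]_(w in ~` A) (stopped_value X th w)%:E.
  move=> fth; rewrite unlock -[X in integral _ X](setUv A) integral_setU//.
    by apply/measurable_EFinP; exact: stopped_measurable.
  by apply/disj_setPS; rewrite setICr.
have := (hstop fr).2; rewrite -(hstop fs).2 !split_int//.
rewrite (eq_integral (fun w => (stopped_value X tau w)%:E)); last first.
  by move=> w /[!inE] Aw; rewrite (stopped_value_eq (rA w Aw)).
rewrite [X in _ + X](eq_integral
  (fun w => (stopped_value X sigma w)%:E)); last first.
  by move=> w /[!inE] Aw; rewrite (stopped_value_eq (rC w Aw)).
have Cfin : \int[P]_(w in ~` A) (stopped_value X sigma w)%:E \is a fin_num.
  apply: integrable_fin_num => //.
  by apply: L1_integrable => //; exact: stopped_L1.
move/(congr1 (fun x => x - \int[P]_(w in ~` A) (stopped_value X sigma w)%:E)).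
by rewrite !addeK.
Qed.

(** Events about the value at sigma are prior to sigma and, within A, to tau, so
    on A the value at sigma is the conditional mean of the value at tau. *)
Lemma le_integral_excess_stopped K sigma tau A : (0 <= K)%R ->
  finite_stopping_time P F sigma -> finite_stopping_time P F tau ->
  prior F sigma A -> (forall w, A w -> sigma w <= tau w) ->
  \int[P]_(w in A) (excess K (stopped_value X sigma w))%:E <=
  \int[P]_(w in A) (excess K (stopped_value X tau w))%:E.
Proof.
move=> K0 fs ft sA st; apply: le_integral_excess => //.
- by case: sA.
- exact: stopped_L1.
- exact: stopped_L1.
move=> B mB; have sAB : prior F sigma (A `&` stopped_value X sigma @^-1` B).
  apply: priorI => //; first exact: fs.1.
  by apply: prior_stopped_value => //; [exact: fs.1|exact: stopped_measurable].
apply: integral_stopped_eq => //.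
by apply: le_prior sAB => //; [exact: ft.1|move=> w [/st]].
Qed.

(** If the conclusion failed for a, then past every k there would be a shell
    G k \ G m and a time tau with E[|X_tau|; shell] > a.  Iterating gives
    disjoint shells, and the time pasted from the tau's along them has an
    integral of at least n a for all n. *)
Lemma exists_small_tail rho (G : (set T)^nat) (a : R) :
  finite_stopping_time P F rho -> (forall n, prior F rho (G n)) ->
  nonincreasing_seq G -> P (\bigcap_n G n) = 0 -> (0 < a)%R ->
  exists k, forall tau, finite_stopping_time P F tau ->
    (forall w, rho w <= tau w) ->
    \int[P]_(w in G k) `|stopped_value X tau w|%:E <= a%:E.
Proof.
move=> fr pG niG G0 a0; apply: contrapT => /forallNP H.
have mG n : measurable (G n) by case: (pG n).
have step k : exists mt : nat * (T -> \bar R),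
    [/\ (k < mt.1)%N, finite_stopping_time P F mt.2,
        forall w, rho w <= mt.2 w &
        a%:E < \int[P]_(w in G k `\` G mt.1) `|stopped_value X mt.2 w|%:E].
  have /existsNP[tau /not_implyP[ft /not_implyP[rt /negP]]] := H k.
  rewrite -ltNge => a_lt.
  have abs0 w : 0 <= `|stopped_value X tau w|%:E by rewrite lee_fin.
  have [m km am] := exists_integral_setD
    (stopped_abs_measurable (A := setT) ft) abs0
    mG niG G0 a_lt.
  by exists (m, tau).
have [f fP] := choice step.
(* The i-th shell lies between the indices k_ i and k_ i.+1; t_ i is the time
   with mass above a on it. *)
pose k_ i := iter i (fun k => (f k).1) 0%N.
pose t_ i := (f (k_ i)).2.
(* seqDU B i contains the i-th shell; taking B i instead of the shell puts the
   complement of G 0 into the first piece, so that the pieces cover almost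
   everything. *)
pose B i := ~` G (k_ i.+1).
have ft_ i : finite_stopping_time P F (t_ i) by case: (fP (k_ i)).
have rt_ i w : rho w <= t_ i w by case: (fP (k_ i)).
have pA i : prior F (t_ i) (seqDU B i).
  apply: le_prior (ft_ i).1 (fun w _ => rt_ i w) _ => //.
  apply: prior_seqDU => //; first exact: fr.1.
  by move=> j _; apply: priorC => //; exact: fr.1.
have tA : trivIset [set: nat] (seqDU B) by exact: trivIset_seqDU.
have k_ge i : (i <= k_ i)%N.
  elim: i => // i IH; apply: leq_ltn_trans IH _.
  by rewrite /k_ iterS; case: (fP (k_ i)).
pose th := paste (seqDU B) t_.
have fth : finite_stopping_time P F th.
  apply: finite_stopping_time_paste => //.
  exists (\bigcap_n G n); split => //; first exact: bigcapT_measurable.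
  move=> w /= nw n _; apply: contrapT => nGw; apply: nw.
  rewrite -seqDU_bigcup_eq; exists n => // Gk; apply: nGw.
  have /subsetPset : (G (k_ n.+1) <= G n)%O.
    by apply: niG; apply: leq_trans (k_ge _).
  exact.
have piece i : a%:E <= \int[P]_(w in seqDU B i) `|stopped_value X th w|%:E.
  rewrite (eq_integral (fun w => `|stopped_value X (t_ i) w|%:E)); last first.
    move=> w /[!inE] Aw; congr (`|_|%:E); apply: stopped_value_eq.
    exact: pasteE.
  have [_ _ _ /ltW/le_trans] := fP (k_ i); apply.
  apply: ge0_subset_integral => //.
  - exact: measurableD.
  - exact: (pA i).1.
  - exact: stopped_abs_measurable (ft_ i).
  - move=> w [Gw nGw]; split => //; rewrite -bigcup_mkord => -[j /= ji]; apply.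
    have /subsetPset : (G (k_ i) <= G (k_ j.+1))%O.
      apply: niG; elim: i ji {Gw nGw} => // i IH; rewrite ltnS leq_eqVlt.
      case/predU1P => [->//|/IH/leq_trans]; apply.
      by apply: ltnW; rewrite /k_ !iterS; case: (fP (k_ i)).
    exact.
have n_le n : (n%:R * a)%:E <= \int[P]_w `|stopped_value X th w|%:E.
  have mA i : measurable (seqDU B i) by exact: (pA i).1.
  have -> : (n%:R * a)%:E = \sum_(i <- iota 0 n) a%:E.
    rewrite sumEFin big_const_seq count_predT size_iota.
    by rewrite iter_addr_0 mulr_natl.
  apply: (@le_trans _ _ (\sum_(i <- iota 0 n)
      \int[P]_(w in seqDU B i) `|stopped_value X th w|%:E)).
    by apply: lee_sum => i _; exact: piece.
  rewrite -ge0_integral_bigsetU//.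
  - apply: ge0_subset_integral => //; first exact: bigsetU_measurable.
    exact: stopped_abs_measurable.
  - exact: iota_uniq.
  - exact: sub_trivIset tA.
  - exact: stopped_abs_measurable.
have /integrableP[_] := stopped_L1 fth; rewrite /=.
set I := (X in X < _) => Ioo.
have I_fin : I \is a fin_num by rewrite ge0_fin_numE// integral_ge0.
have := n_le (Num.trunc (fine I / a)).+1.
by rewrite -/I -(fineK I_fin) lee_fin -ler_pdivlMr// leNgt truncnS_gt.
Qed.

(** * Boundedness in L1 *)

Definition bounded_after eta A : Prop := exists c : R, forall tau,
  finite_stopping_time P F tau -> (forall w, eta w <= tau w) ->
  \int[P]_(w in A) `|stopped_value X tau w|%:E <= c%:E.

Lemma bounded_afterS eta A B : measurable A -> measurable B -> A `<=` B ->
  bounded_after eta B -> bounded_after eta A.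
Proof.
move=> mA mB AB [c cP]; exists c => tau ft et; apply: le_trans (cP tau ft et).
by apply: ge0_subset_integral => //; exact: stopped_abs_measurable.
Qed.

Lemma bounded_afterU eta A B : measurable A -> measurable B ->
  bounded_after eta A -> bounded_after eta B -> bounded_after eta (A `|` B).
Proof.
move=> mA mB [a aP] [b bP]; exists (a + b)%R => tau ft et.
rewrite (_ : A `|` B = A `|` (B `\` A)); last first.
  apply/seteqP; split => w /=; last by tauto.
  by have [] := pselect (A w); tauto.
rewrite ge0_integral_setU//.
- rewrite EFinD; apply: leeD; first exact: aP.
  apply: le_trans (bP tau ft et); apply: ge0_subset_integral => //.
  + exact: measurableD.
  + exact: stopped_abs_measurable.
- exact: measurableD.
- exact: stopped_abs_measurable.
- by apply/disj_setPS => w [Aw []].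
Qed.

(** If the masses that times after eta put on the whole space were unbounded,
    the supremum s of the x such that they are bounded on {U <= x} would be a
    real number around which they are unbounded; but the events
    {s - 1/n < U <= s + 1/n} decrease to the null event {U = s}. *)
Lemma stopped_L1_bounded (U : T -> R) eta : finite_stopping_time P F eta ->
  (forall B : set R, measurable B -> prior F eta (U @^-1` B)) ->
  (forall x, P (U @^-1` [set x]) = 0) ->
  exists c : R, forall tau, finite_stopping_time P F tau ->
    \int[P]_w `|stopped_value X tau w|%:E <= c%:E.
Proof.
move=> fe pU U0.
have mU (B : set R) : measurable B -> measurable (U @^-1` B) by move=> /pU[].
(* Replacing tau by the maximum of eta and tau does not decrease E|X_tau|. *)
suff [c cP] : bounded_after eta [set: T].
  exists c => tau ft; pose th w := maxe (eta w) (tau w).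
  have fth : finite_stopping_time P F th by exact: finite_stopping_time_max.
  apply: le_trans (cP th fth _); last by move=> w; rewrite le_max lexx.
  under eq_integral do rewrite -excess0.
  under [leRHS]eq_integral do rewrite -excess0.
  apply: le_integral_excess_stopped => //; first exact: priorT ft.1.
  by move=> w _; rewrite le_max lexx orbT.
have small (J : (set R)^nat) : (forall n, measurable (J n)) ->
    nonincreasing_seq J -> P (U @^-1` \bigcap_n J n) = 0 ->
    exists k, bounded_after eta (U @^-1` J k).
  move=> mJ niJ J0.
  have [| | |k kP] := @exists_small_tail eta
      (fun n => U @^-1` J n) 1%R fe _ _ _ ltr01.
  - by move=> n; exact: pU.
  - move=> m n mn; apply/subsetPset => w.
    by have /subsetPset := niJ _ _ mn; exact.
  - by rewrite -preimage_bigcap.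
  - by exists k, 1%R.
apply: contrapT => unbounded.
(* Boundedness where U is very negative or very large, by the tail lemma; this
   makes the supremum below a real number. *)
have [l lP] : exists l : nat, bounded_after eta (U @^-1` `]-oo, (- l%:R)%R]).
  apply: small => //.
  - move=> m n mn; apply/subsetPset => x /=.
    rewrite !in_itv/= => /le_trans; apply.
    by rewrite lerN2 ler_nat.
  - rewrite (_ : \bigcap_n _ = set0) ?preimage_set0//.
    apply/seteqP; split => // x xP; have := xP (Num.trunc (- x)%R).+1 I.
    by rewrite /= in_itv/= lerNr leNgt truncnS_gt.
have [u uP] : exists u : nat, bounded_after eta (U @^-1` `]u%:R, +oo[).
  apply: small => //.
  - move=> m n mn; apply/subsetPset => x /=; rewrite !in_itv/= !andbT.
    by apply: le_lt_trans; rewrite ler_nat.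
  - rewrite (_ : \bigcap_n _ = set0) ?preimage_set0//.
    apply/seteqP; split => // x xP; have := xP (Num.trunc x).+1 I.
    by rewrite /= in_itv/= andbT ltNge ltW// truncnS_gt.
pose S := [set x : R | bounded_after eta (U @^-1` `]-oo, x])].
have Sub x : S x -> (x <= u%:R)%R.
  move=> Sx; rewrite leNgt; apply/negP => ux; apply: unbounded.
  rewrite (_ : setT = U @^-1` `]-oo, x] `|` U @^-1` `]u%:R, +oo[).
    by apply: bounded_afterU => //; exact: mU.
  apply/seteqP; split => // w _; rewrite /setU /preimage /= !in_itv/= andbT.
  by have [|/(lt_trans ux)] := leP (U w) x; [left|right].
have supS : has_sup S.
  by split; [exists (- l%:R)%R|exists u%:R].
pose J (n : nat) := `](sup S - n.+1%:R^-1)%R, (sup S + n.+1%:R^-1)%R]%classic.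
have [k kP] : exists k, bounded_after eta (U @^-1` J k).
  apply: small => //.
  - by move=> n; exact: measurable_itv.
  - move=> m n mn; apply/subsetPset => x; rewrite /J/= !in_itv/=.
    have : (n.+1%:R^-1 <= m.+1%:R^-1 :> R)%R.
      by rewrite lef_pV2// ?posrE// ler_nat.
    move: (n.+1%:R^-1)%R (m.+1%:R^-1)%R => a b ab.
    by move=> /andP[? ?]; apply/andP; split; lra.
  - rewrite (_ : \bigcap_n _ = [set sup S])//.
    apply/seteqP; split => [x xP /=|_ -> n _]; last first.
      rewrite /J/= in_itv/= ltrBlDr ltrDl invr_gt0 ltr0n.
      by rewrite lerDl invr_ge0 ler0n.
    apply: contrapT => /eqP; rewrite -subr_eq0 -normr_gt0 => e0.
    have := xP (Num.trunc (`|x - sup S|^-1)%R) I; rewrite /J/= in_itv/=.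
    have : ((Num.trunc (`|x - sup S|^-1)%R).+1%:R^-1 < `|x - sup S|)%R.
      by rewrite invf_plt ?posrE// truncnS_gt.
    by move: (_^-1)%R => a; case: ler0P => _ lt /andP[? ?]; lra.
have mJk : measurable (U @^-1` J k) by apply: mU; exact: measurable_itv.
pose e : R := (k.+1%:R^-1)%R.
have e0 : (0 < e)%R by rewrite invr_gt0.
have [x Sx xe] := sup_adherent e0 supS.
(* ]-oo, s + e] is covered by ]-oo, x] and J k, with x in S and s - e < x. *)
have : S (sup S + e)%R.
  apply: (@bounded_afterS _ _ (U @^-1` `]-oo, x] `|` U @^-1` J k)).
  - exact: mU.
  - by apply: measurableU => //; exact: mU.
  - move=> w; rewrite /setU /preimage /J /= -/e !in_itv/= => ->; rewrite andbT.
    by have [|/(lt_trans xe)] := leP (U w) x; [left|right].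
  - by apply: bounded_afterU => //; exact: mU.
by move=> /(ub_le_sup supS.2); lra.
Qed.

(** * Uniform integrability of the stopped values *)

Hypothesis hbounded : exists c : R, forall tau, finite_stopping_time P F tau ->
  \int[P]_w `|stopped_value X tau w|%:E <= c%:E.

Definition near_optimal K (e : R) sigma : Prop :=
  forall tau, finite_stopping_time P F tau ->
  \int[P]_w (excess K (stopped_value X tau w))%:E <=
  \int[P]_w (excess K (stopped_value X sigma w))%:E + e%:E.

Lemma exists_near_optimal K e : (0 <= K)%R -> (0 < e)%R ->
  exists2 sigma, finite_stopping_time P F sigma & near_optimal K e sigma.
Proof.
move=> K0 e0; have [c cP] := hbounded.
pose V := [set \int[P]_w (excess K (stopped_value X tau w))%:E |
            tau in finite_stopping_time P F].
have supV_fin : ereal_sup V \is a fin_num.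
  rewrite fin_numE -ltNye -ltey; apply/andP; split.
    apply: (@lt_le_trans _ _ 0) => //.
    have f0 := finite_stopping_time_cst P hF (lexx 0%R).
    apply: le_trans (ereal_sup_ubound (_ : V _)); last by exists (cst 0).
    by apply: integral_ge0 => w _; rewrite lee_fin excess_ge0.
  apply: (@le_lt_trans _ _ c%:E); last exact: ltry.
  apply: ge_ereal_sup => _ [tau ft <-]; apply: le_trans (cP tau ft).
  apply: excess_le_integral => //; exact: stopped_L1.
have [_ [sigma fs <-] lt_s] := ub_ereal_sup_adherent e0 supV_fin.
exists sigma => // tau ft; apply: (@le_trans _ _ (ereal_sup V)).
  by apply: ereal_sup_ubound; exists tau.
by rewrite -leeBlDr// ltW.
Qed.

Lemma near_optimal_later K e sigma tau : (0 <= K)%R ->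
  finite_stopping_time P F sigma -> finite_stopping_time P F tau ->
  (forall w, sigma w <= tau w) ->
  near_optimal K e sigma -> near_optimal K e tau.
Proof.
move=> K0 fs ft st os th fth; apply: le_trans (os th fth) _.
apply: leeD => //; apply: le_integral_excess_stopped => //.
exact: priorT fs.1.
Qed.

Lemma integral_excess_setC K tau A : measurable A ->
  finite_stopping_time P F tau ->
  \int[P]_w (excess K (stopped_value X tau w))%:E =
  \int[P]_(w in A) (excess K (stopped_value X tau w))%:E +
  \int[P]_(w in ~` A) (excess K (stopped_value X tau w))%:E.
Proof.
move=> mA ft; rewrite -[X in integral _ X](setUv A) ge0_integral_setU//.
- exact: measurableC.
- exact: stopped_excess_measurable.
- by move=> w _; rewrite lee_fin excess_ge0.
- by apply/disj_setPS; rewrite setICr.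
Qed.

(** The value at sigma has no excess over K on A, so switching there from sigma
    to tau raises the mean excess by the whole excess of tau on A; near
    optimality bounds this gain by e. *)
Lemma near_optimal_small K e sigma tau A : (0 <= K)%R ->
  finite_stopping_time P F sigma -> finite_stopping_time P F tau ->
  near_optimal K e sigma -> prior F sigma A -> prior F tau A ->
  (forall w, A w -> (`|stopped_value X sigma w| <= K)%R) ->
  \int[P]_(w in A) (excess K (stopped_value X tau w))%:E <= e%:E.
Proof.
move=> K0 fs ft os sA tA AK.
have [rho [fr rA rC]] := exists_switch fs ft sA tA.
have mA : measurable A by exact: sA.1.
have mC : measurable (~` A) by exact: measurableC.
have := os rho fr; rewrite !(integral_excess_setC K mA)//.
rewrite (eq_integral
  (fun w => (excess K (stopped_value X tau w))%:E)); last first.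
  by move=> w /[!inE] Aw; rewrite (stopped_value_eq (rA w Aw)).
rewrite [X in _ + X <= _](eq_integral
  (fun w => (excess K (stopped_value X sigma w))%:E)); last first.
  by move=> w /[!inE] Aw; rewrite (stopped_value_eq (rC w Aw)).
rewrite [X in _ <= X + _ + _](_ : _ = 0); last first.
  rewrite (eq_integral (cst 0)) ?integral0// => w /[!inE] Aw.
  by rewrite excess_eq0// AK.
rewrite add0e addeC leeD2lE//; apply: integrable_fin_num => //.
by apply: (@integrable_excess _ _ _ P) => //; exact: stopped_L1.
Qed.

(** Near optimal times s i for the levels i are used one after the other: a
    time rho stops at the first s i at which |X| <= i.  A later value cannot
    have a large excess over i on the piece where rho = s i; the pieces with
    i < k are treated in this way, at the level k, and the remaining ones have
    small total mass for k large. *)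
Lemma exists_uniform_excess (e : R) : (0 < e)%R ->
  exists2 K : R, (0 <= K)%R & forall tau, finite_stopping_time P F tau ->
    \int[P]_w (excess K (stopped_value X tau w))%:E <= e%:E.
Proof.
move=> e0; pose h := (e / 2)%R; have h0 : (0 < h)%R by rewrite divr_gt0.
(* Half of e pays for the pieces of index i < k, e_ i for the i-th of them; the
   other half pays for the tail. *)
pose e_ (i : nat) := (h / 2 ^+ i.+1)%R.
have e_gt0 i : (0 < e_ i)%R by rewrite divr_gt0// exprn_gt0.
have /choice [best bestP] : forall i : nat, exists sigma,
    finite_stopping_time P F sigma /\ near_optimal i%:R (e_ i) sigma.
  move=> i; have [s fs os] := exists_near_optimal (ler0n R i) (e_gt0 i).
  by exists s.
pose s := fix s i :=
  if i is j.+1 then fun w => maxe (s j w) (best i w) else best 0%N.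
have fs i : finite_stopping_time P F (s i).
  elim: i => [|i IH]; first exact: (bestP 0%N).1.
  exact: finite_stopping_time_max IH (bestP i.+1).1.
have s_mono i j w : (i <= j)%N -> s i w <= s j w.
  move=> /subnK <-; elim: (j - i)%N => // n IH.
  by rewrite addSn /= le_max IH.
have os i : near_optimal i%:R (e_ i) (s i).
  case: i => [|i]; first exact: (bestP 0%N).2.
  apply: near_optimal_later (bestP i.+1).2 => //; first exact: (bestP i.+1).1.
  by move=> w /=; rewrite le_max lexx orbT.
(* The sets A i are the pieces on which i is the first index with |X| <= i at
   time s i. *)
pose B i := stopped_value X (s i) @^-1` [set x | (`|x| <= i%:R)%R].
have pB i : prior F (s i) (B i).
  apply: (prior_stopped_value hF hX (fs i).1).
    exact: stopped_measurable.
  rewrite (_ : [set _ | _] = `[(- i%:R)%R, i%:R]%classic) ?measurable_itv//.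
  by rewrite set_itvcc; apply/seteqP; split=> x /=; rewrite ler_norml.
pose A := seqDU B.
have pA i : prior F (s i) (A i).
  apply: (prior_seqDU hF (fs i).1) => j ji.
  by apply: (le_prior hF (fs i).1 _ (pB j)) => w _; exact: s_mono.
have tA : trivIset [set: nat] A by exact: trivIset_seqDU.
have mA i : measurable (A i) by exact: (pA i).1.
pose G n := ~` \big[setU/set0]_(i < n) A i.
have mG n : measurable (G n).
  by apply: measurableC; exact: bigsetU_measurable.
have niG : nonincreasing_seq G.
  by move=> m n mn; apply/subsetPset; apply: subsetC; exact: subset_bigsetU.
(* G n is the event that |X| > i at time s i for all i < n. *)
have G0 : P (\bigcap_n G n) = 0.
  have [c cP] := hbounded.
  apply: (null_of_L1_bounded (Y := fun n => stopped_value X (s n)) (c := c)).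
  - exact: bigcapT_measurable.
  - by move=> n; exact: stopped_L1 (fs n).
  - by move=> n; exact: cP (fs n).
  - move=> n w /(_ n.+1 I); rewrite /G /A -bigsetU_seqDU big_ord_recr/= => nB.
    by rewrite ltW// ltNge; apply/negP => le_n; apply: nB; right.
pose rho := paste A s.
have fr : finite_stopping_time P F rho.
  apply: (finite_stopping_time_paste hF tA _ fs pA).
  exists (\bigcap_n G n); split => //; first exact: bigcapT_measurable.
  move=> w /= nw n _; rewrite /G -bigcup_mkord => -[i _ Aiw].
  by apply: nw; exists i.
have pG n : prior F rho (G n).
  apply: (priorC hF fr.1); rewrite -(priorE hF fr.1).
  apply: bigsetU_measurable => i _; rewrite (priorE hF fr.1).
  by apply: (prior_paste hF i tA _ pA) => j; exact: (fs j).1.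
have [k kP] := exists_small_tail fr pG niG G0 h0.
exists k%:R => // tau ft.
pose th w := maxe (rho w) (tau w).
have fth : finite_stopping_time P F th by exact: finite_stopping_time_max.
have rth w : rho w <= th w by rewrite le_max lexx.
(* It suffices to treat times after rho, as tau can be replaced by the maximum
   of rho and tau. *)
apply: (@le_trans _ _ (\int[P]_w (excess k%:R (stopped_value X th w))%:E)).
  apply: le_integral_excess_stopped => //.
    exact: priorT ft.1.
  by move=> w _; rewrite le_max lexx orbT.
have mAk : measurable (\big[setU/set0]_(i < k) A i).
  exact: bigsetU_measurable.
rewrite (integral_excess_setC _ mAk fth).
have -> : e = (h + h)%R by rewrite /h; field.
rewrite EFinD; apply: leeD; last first.
  apply: le_trans (kP th fth rth); apply: excess_le_integral => //.
    exact: stopped_L1.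
  exact: mG.
rewrite -(big_mkord xpredT) ge0_integral_bigsetU//; last 4 first.
- exact: iota_uniq.
- exact: sub_trivIset tA.
- exact: stopped_excess_measurable.
- by move=> w _; rewrite lee_fin excess_ge0.
rewrite big_mkord.
apply: (@le_trans _ _ (\sum_(i < k) (e_ i)%:E)); last first.
  rewrite sumEFin lee_fin sum_geometric.
  by rewrite ler_piMr ?ltW// gerBl invr_ge0 exprn_ge0.
apply: lee_sum => i _.
apply: (@le_trans _ _
  (\int[P]_(w in A i) (excess i%:R (stopped_value X th w))%:E)).
  apply: ge0_le_integral => //.
  - by move=> w _; rewrite lee_fin excess_ge0.
  - exact: stopped_excess_measurable.
  - exact: stopped_excess_measurable.
  - by move=> w _; rewrite lee_fin le_excess// ler_nat ltnW.
apply: (near_optimal_small _ (fs i) fth (os i)) => //.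
  apply: (le_prior hF fth.1 _ (pA i)) => w Aiw.
  by rewrite -(pasteE s tA Aiw); exact: rth.
by move=> w Aiw; exact: (subset_seqDU Aiw).
Qed.

End constant_mean.

Theorem theorem2 (R : realType) (d : measure_display) (T : measurableType d)
    (P : probability T R) (F : R -> set (set T)) (X : R -> T -> R)
    (hF : filtration F)
    (hXprog : progressively_measurable F X)
    (hXrc : as_right_continuous P X)
    (hstop : forall tau : T -> \bar R, finite_stopping_time P F tau ->
       L1 P (stopped_value X tau) /\
       'E_P[stopped_value X tau] = 'E_P[X 0%R])
    (hU : exists (U : {RV P >-> R}) (eta : T -> \bar R),
       [/\ forall B : set R, measurable B ->
             distribution P U B = uniform_prob (@ltr01 R) B,
           finite_stopping_time P F eta &
           measurable_wrt (stopped_sigma_algebra F eta) U]) :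
  martingale P F X /\
  uniformly_integrable P [set t : R | (0 <= t)%R] X.
Proof.
have stopped_cst t : stopped_value X (cst t%:E) = X t by [].
have f_cst t : (0 <= t)%R -> finite_stopping_time P F (cst t%:E).
  exact: finite_stopping_time_cst.
have X1 t : (0 <= t)%R -> L1 P (X t).
  move=> t0; rewrite -(stopped_cst t).
  exact: (stopped_L1 hstop (f_cst t t0)).
split.
- split; [by move=> t; exact: (progressive_adapted hXprog)|exact: X1|].
  move=> s t /andP[s0 st]; have t0 := le_trans s0 st.
  split; [exact: (progressive_adapted hXprog)|exact: X1|move=> A FA].
  rewrite -(stopped_cst s) -(stopped_cst t).
  apply: (integral_stopped_eq hF hstop (f_cst s s0) (f_cst t t0)).
    by apply: (prior_cst hF _ FA); rewrite s0 lexx.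
  by apply: (prior_cst hF _ FA); rewrite s0 st.
- have [U [eta [UE fe mU]]] := hU.
  have bounded := stopped_L1_bounded hF hXprog hstop fe
    (fun B => prior_of_measurable_wrt hF fe.1 mU)
    (fun x => uniform_atomless x UE).
  apply: uniformly_integrable_excess; [by exists 0%R => /=|exact: X1|].
  move=> e e0.
  have [K K0 KP] := exists_uniform_excess hF hXprog hstop bounded e0.
  by exists K => // t t0; rewrite -(stopped_cst t); apply: KP; exact: f_cst.
Qed.
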